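(* For every integer $\Delta\ge1$ there is a constant $c_\Delta$ (depending only on $\Delta$) such that the following holds for all integers $n\ge 2$ and $d\ge 1$. Let $U$ and $U'$ be two graphs with maximum degree $d$. If $U$ contains every $n$-vertex graph of maximum degree at most $\Delta$ as an induced subgraph and $U'$ contains every $n$-vertex graph of maximum degree at most $\Delta$ as a subgraph, then \[ |V(U)|\ge \exp\Big(n\big((\Delta/2-1)\log n-c_\Delta-\log(4d)\big)\Big) \] and \[ |V(U')|\ge \exp\Big(n\big((\Delta/2-1)\log n-c_\Delta-\log(4d)-2\Delta\log\tfrac{de}{\Delta}\big)\Big). \] In particular, if $d=n^{o(1)}$ as $n\to\infty$, then $|V(U)|\ge n^{(\Delta/2-1-o(1))n}$ and $|V(U')|\ge n^{(\Delta/2-1-o(1))n}$.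
   Context: $\log$ denotes the natural logarithm. ''$U$ contains $H$ as a (induced) subgraph'' means $U$ has a (induced) subgraph isomorphic to $H$. *)

(* Defs.v *)
From HB Require Import structures.
From mathcomp Require Import all_boot.
Set Implicit Arguments.
Unset Strict Implicit.
Unset Printing Implicit Defensive.

Record sgraph := SGraph {
  vertex :> finType;
  edge : rel vertex;
  edge_sym : symmetric edge;
  edge_irr : irreflexive edge
}.

Definition degree (G : sgraph) (v : G) : nat := #|[set w : G | edge v w]|.

Definition max_degree (G : sgraph) : nat := \max_(v : G) degree v.

Definition isomorphic (G H : sgraph) : Prop :=
  exists2 f : G -> H, bijective f & {mono f : u v / edge u v}.

Section Subgraph.
Variables (G : sgraph) (A : {set G}) (e : rel G).
Hypotheses (e_sym : symmetric e) (e_irr : irreflexive e).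

Definition sub_edge : rel {x : G | x \in A} := fun u v => e (val u) (val v).

Fact sub_edge_sym : symmetric sub_edge.
Proof. by move=> u v; apply: e_sym. Qed.

Fact sub_edge_irr : irreflexive sub_edge.
Proof. by move=> u; apply: e_irr. Qed.

(* This is a subgraph of G only when e is a subrelation of edge; edges of e
   leaving A are dropped. *)
Definition subgraph : sgraph := SGraph sub_edge_sym sub_edge_irr.

End Subgraph.

Definition induced_subgraph (G : sgraph) (A : {set G}) : sgraph :=
  subgraph A (@edge_sym G) (@edge_irr G).

Definition contains (U H : sgraph) : Prop :=
  exists (A : {set U}) (e : rel U) (es : symmetric e) (ei : irreflexive e),
    subrel e (@edge U) /\ isomorphic (subgraph A es ei) H.

Definition contains_induced (U H : sgraph) : Prop :=
  exists A : {set U}, isomorphic (induced_subgraph A) H.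

Definition universal (Delta n : nat) (U : sgraph) : Prop :=
  forall H : sgraph, #|H| = n -> max_degree H <= Delta -> contains U H.

Definition induced_universal (Delta n : nat) (U : sgraph) : Prop :=
  forall H : sgraph, #|H| = n -> max_degree H <= Delta -> contains_induced U H.

(* Main.v *)
(** Let [m = n./2] and [k = Delta - 2]. A [k]-tuple of permutations of [m]
    points defines a graph of maximum degree at most [Delta] on [n] vertices:
    the path [0, 1, ..., n - 1] together with [k] perfect matchings between
    [0, ..., m - 1] and [m, ..., 2 m - 1]. An embedding of it in [U] is a walk
    with [n] vertices, so there are at most [#|U| * d ^ n] of them. Given the
    embedding, each of the [k m] matching edges is determined by the position
    of its upper end in a list of neighbours of its lower end, of length at
    most [Delta] for an induced embedding (the walk determines the embedded
    graph) and at most [d] in general. Hence [m! ^ k <= #|U| d ^ n D ^ (k m)]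
    with [D = Delta] or [D = d]; take logarithms. Connectedness through a
    spanning path is what avoids dividing by the number of isomorphisms. *)
Require Import Defs.
From mathcomp Require Import all_boot all_order all_algebra all_fingroup.
From mathcomp Require Import all_classical all_reals all_analysis.
From mathcomp Require Import zify ring lra.
Import Order.TTheory GRing.Theory Num.Theory.
Import numFieldNormedType.Exports.

(** * The test graphs: a path with added matchings *)

Definition matching_edge m n (s : 'S_m) : rel 'I_n := fun u v =>
  [exists i : 'I_m, (u == i :> nat) && (v == m + s i :> nat)
                 || (v == i :> nat) && (u == m + s i :> nat)].

Definition consecutive n : rel 'I_n := fun u v =>
  (u.+1 == v :> nat) || (v.+1 == u :> nat).

Definition path_matchings_edge k m n (s : {ffun 'I_k -> 'S_m}) : rel 'I_n :=
  fun u v => consecutive n u v || [exists j, matching_edge m n (s j) u v].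

Lemma matching_edge_inj m n (s : 'S_m) (u v w : 'I_n) :
  matching_edge m n s u v -> matching_edge m n s u w -> v = w.
Proof.
move=> /existsP[i hi] /existsP[j hj]; apply/val_inj => /=.
have := ltn_ord i; have := ltn_ord j; have := ltn_ord (s i).
have := ltn_ord (s j) => sj si lj li.
case/orP: hi => /andP[/eqP a /eqP b]; case/orP: hj => /andP[/eqP a' /eqP b'].
- have eij : i = j by apply/val_inj => /=; lia.
  by rewrite b b' eij.
- by lia.
- by lia.
- have /perm_inj eij : s i = s j by apply/val_inj => /=; lia.
  by rewrite a a' eij.
Qed.

Lemma path_matchings_sym k m n s : symmetric (path_matchings_edge k m n s).
Proof.
move=> u v; rewrite /path_matchings_edge; congr (_ || _); first exact: orbC.
by apply: eq_existsb => j; apply: eq_existsb => i; rewrite orbC.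
Qed.

Lemma path_matchings_irr k m n s : irreflexive (path_matchings_edge k m n s).
Proof.
move=> u; apply/negP => /orP[|/existsP[j /existsP[i]]].
  by rewrite /consecutive; lia.
by have := ltn_ord i; lia.
Qed.

Definition path_matchings k m n s : sgraph :=
  @SGraph 'I_n (path_matchings_edge k m n s)
    (path_matchings_sym k m n s) (path_matchings_irr k m n s).

(** The path gives at most two neighbours and each matching at most one. Edges of different origin
    may coincide, so only an upper bound is available. *)
Lemma path_matchings_max_degree k m n s :
  max_degree (path_matchings k m n s) <= k.+2.
Proof.
apply/bigmax_leqP => u _; rewrite /degree /=.
have -> : [set w | path_matchings_edge k m n s u w] =
    [set w : 'I_n | u.+1 == w] :|: [set w : 'I_n | w.+1 == u] :|:
    \bigcup_j [set w | matching_edge m n (s j) u w].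
  apply/setP => w; rewrite !inE; congr (_ || _).
  apply/existsP/bigcupP => [[j hj]|[j _]]; first by exists j; rewrite ?inE.
  by rewrite inE; exists j.
have bigk : #|\bigcup_j [set w | matching_edge m n (s j) u w]| <= k.
  apply: (@leq_trans (\sum_(j < k) 1)); last by rewrite sum1_card card_ord.
  apply: (big_ind2 (fun (A : {set 'I_n}) x => #|A| <= x)).
  - by rewrite cards0.
  - move=> A x B y hA hB.
    by apply: leq_trans (leq_card_setU _ _) _; apply: leq_add.
  - move=> j _; apply/card_le1_eqP => v w; rewrite !inE => uv uw.
    by apply: matching_edge_inj uw uv.
have one1 : #|[set w : 'I_n | u.+1 == w]| <= 1.
  apply/card_le1_eqP => v w; rewrite !inE => /eqP hv /eqP hw.
  by apply/val_inj => /=; lia.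
have one2 : #|[set w : 'I_n | w.+1 == u]| <= 1.
  apply/card_le1_eqP => v w; rewrite !inE => /eqP hv /eqP hw.
  by apply/val_inj => /=; lia.
apply: leq_trans (leq_card_setU _ _) _; rewrite -[k.+2]/(2 + k).
apply: leq_add => //; apply: leq_trans (leq_card_setU _ _) _.
by rewrite -[2]/(1 + 1); apply: leq_add.
Qed.

(** * Embeddings coded by walks and neighbour lists *)

Lemma containsE (U H : sgraph) : contains U H ->
  exists2 f : H -> U, injective f & {homo f : u v / edge u v}.
Proof.
case=> [A [e [es [ei [sub [f [g fK gK] fmono]]]]]].
exists (fun u => val (g u)).
  by move=> u v /val_inj /(can_inj gK).
move=> u v uv; apply: sub.
by have := fmono (g u) (g v); rewrite !gK uv.
Qed.

Lemma contains_inducedE (U H : sgraph) : contains_induced U H ->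
  exists2 f : H -> U, injective f & {mono f : u v / edge u v}.
Proof.
case=> [A [f [g fK gK] fmono]].
exists (fun u => val (g u)).
  by move=> u v /val_inj /(can_inj gK).
by move=> u v; have := fmono (g u) (g v); rewrite !gK.
Qed.

Definition nbrs (U : sgraph) (v : U) : seq U := enum [set w : U | edge v w].

Fixpoint walk (U : sgraph) (v : U) (c : nat -> nat) i : U :=
  if i is i'.+1 then nth v (nbrs U (walk U v c i')) (c i') else v.

Lemma degree_le (U : sgraph) (v : U) : degree v <= max_degree U.
Proof. exact: leq_bigmax. Qed.

(** Each next vertex is a neighbour of the current one, so its position in [nbrs] encodes the step;
    [c] at [i] holds the step leaving [i]. With this code the default of [nth] in [walk] is never
    reached. *)
Lemma walk_onto (U : sgraph) d n (f : 'I_n.+1 -> U) :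
  max_degree U <= d.+1 -> {homo f : u v / consecutive n.+1 u v >-> edge u v} ->
  exists c : {ffun 'I_n.+1 -> 'I_d.+1},
    forall i, walk U (f ord0) (fun a => c (inord a)) (val i) = f i.
Proof.
move=> degU fE.
exists [ffun a : 'I_n.+1 => inord (index (f (inord a.+1)) (nbrs U (f a)))].
case=> i; elim: i => [|i IH] lti /=; first by congr f; apply/val_inj.
have lti' := ltnW lti; have := IH lti'; rewrite /= => ->.
have Ei : inord i = Ordinal lti' by apply/val_inj; rewrite /= inordK.
have ES : inord i.+1 = Ordinal lti by apply/val_inj; rewrite /= inordK.
rewrite ffunE Ei /= ES.
have mem : f (Ordinal lti) \in nbrs U (f (Ordinal lti')).
  by rewrite mem_enum inE; apply: fE; rewrite /consecutive /= eqxx.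
(* The index is below the degree, hence below [d.+1], so [inord] preserves it. *)
rewrite inordK ?nth_index //.
rewrite (leq_trans _ degU) // (leq_trans _ (degree_le U (f (Ordinal lti')))) //.
by rewrite /degree cardE index_mem.
Qed.

(* [v] and [c] encode a walk [f] in [U]; the graph that [f] pulls back to [n]
   vertices has degrees at most [D.+1], so [b] suffices to pick in it the
   partner of every lower vertex in every matching. *)
Definition decode (U : sgraph) d n D k m
    (x : U * {ffun 'I_n.+1 -> 'I_d.+1} * {ffun 'I_k * 'I_m -> 'I_D.+1}) :
    {ffun 'I_k * 'I_m -> 'I_n.+1} :=
  let f (i : 'I_n.+1) := walk U x.1.1 (fun a => x.1.2 (inord a)) i in
  [ffun p : 'I_k * 'I_m => nth ord0
     (enum [set w : 'I_n.+1 | edge (f (inord p.2)) (f w)]) (x.2 p)].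

(** The image of [g] lies in that of [h], and injectivity makes it as large as [A]. *)
Lemma card_code_le (A B C : finType) (g : A -> B) (h : C -> B) :
  injective g -> (forall a, exists c, h c = g a) -> #|A| <= #|C|.
Proof.
move=> ginj gh; rewrite -(card_codom ginj).
apply: leq_trans (leq_image_card h C).
apply/subset_leq_card/fintype.subsetP => b /codomP[a ->].
by have [c <-] := gh a; apply: codom_f.
Qed.

Lemma count_embeddings (U : sgraph) d n D k m :
  0 < d -> 0 < D -> 0 < n -> m.*2 <= n -> max_degree U <= d ->
  (forall s, exists2 f : 'I_n -> U,
     {homo f : u v / path_matchings_edge k m n s u v >-> edge u v} &
     forall u, #|[set w | edge (f u) (f w)]| <= D) ->
  m`! ^ k <= #|U| * d ^ n * D ^ (k * m).
Proof.
case: d D => [//|d] [//|D] _ _; case: n => [//|n] _ hm degU emb.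
have bound (i : 'I_m) : i < n.+1 by have := ltn_ord i; lia.
have boundS (i : 'I_m) : m + i < n.+1 by have := ltn_ord i; lia.
have cardS : #|{ffun 'I_k -> 'S_m}| = m`! ^ k.
  by rewrite card_ffun card_ord card_Sn.
have cardC : #|{: U * {ffun 'I_n.+1 -> 'I_d.+1} * {ffun 'I_k * 'I_m -> 'I_D.+1}}|
    = #|U| * d.+1 ^ n.+1 * D.+1 ^ (k * m).
  by rewrite !card_prod !card_ffun card_prod !card_ord.
rewrite -cardS -cardC.
(* [g s] lists the upper ends of the matching edges; cancelling [m] recovers every permutation from
   it. *)
pose g (s : {ffun 'I_k -> 'S_m}) : {ffun 'I_k * 'I_m -> 'I_n.+1} :=
  [ffun p : 'I_k * 'I_m => inord (m + s p.1 p.2)].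
have gE s p : g s p = m + s p.1 p.2 :> nat by rewrite ffunE inordK.
apply: (card_code_le _ _ _ g (decode U d n D k m)).
  move=> s t st; apply/ffunP => j; apply/permP => i; apply/val_inj => /=.
  have : g s (j, i) = g t (j, i) :> nat by rewrite st.
  by rewrite !gE => /addnI.
move=> s; have [f fE fD] := emb s.
have fpath : {homo f : u v / consecutive n.+1 u v >-> edge u v}.
  by move=> u v uv; apply: fE; rewrite /path_matchings_edge uv.
have [c hc] := walk_onto U d n f degU fpath.
pose N (p : 'I_k * 'I_m) :=
  enum [set w | edge (f (inord p.2)) (f w)].
exists (f ord0, c, [ffun p : 'I_k * 'I_m => inord (index (g s p) (N p))]).
apply/ffunP => p; rewrite /decode ffunE /=.
have -> : [set w : 'I_n.+1 |
    edge (walk U (f ord0) (fun a => c (inord a)) (inord p.2 : 'I_n.+1))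
         (walk U (f ord0) (fun a => c (inord a)) w)] =
    [set w | edge (f (inord p.2)) (f w)].
  by apply/setP => w; rewrite !inE !hc.
have mem : g s p \in N p.
  rewrite mem_enum inE; apply: fE; apply/orP; right.
  apply/existsP; exists p.1; apply/existsP; exists p.2.
  by rewrite gE inordK ?bound // !eqxx.
rewrite ffunE inordK ?nth_index //.
by apply: leq_trans (fD (inord p.2)); rewrite cardE index_mem.
Qed.

(** An induced embedding pulls [U] back to the embedded graph itself, so [D = k.+2] works. *)
Lemma induced_universal_count k n d (U : sgraph) :
  0 < n -> 0 < d -> max_degree U <= d -> induced_universal k.+2 n U ->
  n./2`! ^ k <= #|U| * d ^ n * k.+2 ^ (k * n./2).
Proof.
move=> n0 d0 degU univ; apply: count_embeddings => //; first by lia.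
move=> s; have degH := path_matchings_max_degree k n./2 n s.
have [f _ fE] := contains_inducedE _ _ (univ (path_matchings k n./2 n s) (card_ord n) degH).
exists f => [u v uv|u]; first by rewrite (fE u v).
apply: leq_trans _ (leq_trans (degree_le (path_matchings k n./2 n s) u) degH).
by apply/eq_leq/eq_card => w; rewrite !inE (fE u w).
Qed.

(** The pullback may have extra edges, but the injective [f] sends neighbours of [u] in it to
    distinct neighbours of [f u] in [U], so [D = d] works. *)
Lemma universal_count k n d (U : sgraph) :
  0 < n -> 0 < d -> max_degree U <= d -> universal k.+2 n U ->
  n./2`! ^ k <= #|U| * d ^ n * d ^ (k * n./2).
Proof.
move=> n0 d0 degU univ; apply: count_embeddings => //; first by lia.
move=> s; have degH := path_matchings_max_degree k n./2 n s.
have [f finj fE] := containsE _ _ (univ (path_matchings k n./2 n s) (card_ord n) degH).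
exists f => [u v uv|u]; first exact: fE.
apply: leq_trans _ (leq_trans (degree_le _ (f u)) degU).
rewrite -(card_imset _ finj); apply/subset_leq_card/fintype.subsetP => _ /imsetP[w hw ->].
by rewrite !inE in hw *.
Qed.

(** * Logarithmic estimates *)

Local Open Scope classical_set_scope.
Local Open Scope ring_scope.

(** A crude Stirling bound: the induction step comes down to m ln(1 + 1/m) <= 1. *)
Lemma ln_factorial_ge (R : realType) (m : nat) :
  m%:R * ln m%:R - m%:R <= ln (m`!%:R : R).
Proof.
elim: m => [|m IH]; first by rewrite fact0 ln1 mul0r subrr.
have [->|m0] := posnP m; first by rewrite !ln1; lra.
have mR : (0 : R) < m%:R by rewrite ltr0n.
have m1R : (0 : R) < m.+1%:R by rewrite ltr0n.
have step : m%:R * (ln m.+1%:R - ln m%:R) <= (1 : R).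
  rewrite -ln_div ?posrE // -natr1 mulrDl divff ?gt_eqF // mul1r.
  have inv_gt0 : (0 : R) < m%:R^-1 by rewrite invr_gt0.
  have h : ln (1 + m%:R^-1) <= (m%:R^-1 : R) by apply: le_ln1Dx; lra.
  by rewrite -(ler_pM2l mR) divff ?gt_eqF // in h.
rewrite factS natrM lnM ?posrE ?ltr0n ?fact_gt0 // -natr1.
rewrite natr1 in step *; move: step IH; rewrite -natr1; lra.
Qed.

(** Write m for [n./2]. At most n/2 is lost to rounding (n <= 2m + 1 and ln n < n), 2m <= n to
    replacing ln n by ln m (n <= 3m and ln 3 <= 2), and m <= n/2 in the factorial bound: 2n
    altogether. *)
Lemma ln_factorial_half_ge (R : realType) (n : nat) : (2 <= n)%N ->
  n%:R / 2 * ln n%:R - 2 * n%:R <= ln (n./2`!%:R : R).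
Proof.
move=> n2; apply: le_trans (ln_factorial_ge R n./2).
set m := n./2; have m1 : (0 < m)%N by rewrite /m; lia.
have mR : (0 : R) < m%:R by rewrite ltr0n.
have nR : (0 : R) < n%:R by rewrite ltr0n; lia.
have ub : (2 * m%:R : R) <= n%:R by rewrite -natrM ler_nat /m; lia.
have lb : (n%:R : R) <= 2 * m%:R + 1.
  by rewrite -natrM natr1 ler_nat /m; lia.
have n3m : (n%:R : R) <= 3 * m%:R by rewrite -natrM ler_nat /m; lia.
have lnn0 : 0 <= ln (n%:R : R) by apply: ln_ge0; rewrite ler1n; lia.
have lnn : ln (n%:R : R) < n%:R by apply: ln_sublinear.
have ln3 : ln (3 : R) <= 2.
  by rewrite (_ : 3 = 1 + 2 :> R) ?le_ln1Dx //; lra.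
have lnm : ln (n%:R : R) <= 2 + ln m%:R.
  apply: le_trans (_ : ln (3 * m%:R) <= _).
    by rewrite ler_ln ?posrE // mulr_gt0.
  by rewrite lnM ?posrE //; lra.
have h1 : m%:R * ln (n%:R : R) <= m%:R * (2 + ln m%:R) by rewrite ler_pM2l.
have h2 : n%:R * ln (n%:R : R) <= (2 * m%:R + 1) * ln n%:R.
  by apply: ler_wpM2r.
lra.
Qed.

Lemma ln_card_ge (R : realType) (n k d D N : nat) :
  (2 <= n)%N -> (0 < d)%N -> (0 < D)%N ->
  (n./2`! ^ k <= N * d ^ n * D ^ (k * n./2))%N ->
  n%:R * (k%:R / 2 * ln n%:R - 2 * k%:R - ln d%:R - k%:R / 2 * ln D%:R)
    <= ln (N%:R : R).
Proof.
move=> n2 d0 D0 count.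
have N0 : (0 < N)%N.
  have fact_exp_gt0 : (0 < n./2`! ^ k)%N by rewrite expn_gt0 fact_gt0.
  by move: (leq_trans fact_exp_gt0 count); rewrite -mulnA muln_gt0 => /andP[].
have dR : (0 : R) < d%:R by rewrite ltr0n.
have DR : (0 : R) < D%:R by rewrite ltr0n.
have NR : (0 : R) < N%:R by rewrite ltr0n.
have : k%:R * ln (n./2`!%:R : R) <=
    ln N%:R + n%:R * ln d%:R + k%:R * n./2%:R * ln D%:R.
  rewrite -natrM !mulr_natl -!lnXn ?ltr0n ?fact_gt0 //.
  rewrite -!lnM ?posrE ?mulr_gt0 ?exprn_gt0 // -!natrX -!natrM.
  by rewrite ler_ln ?posrE ?ltr0n ?expn_gt0 ?fact_gt0 // ?muln_gt0
    ?N0 ?expn_gt0 ?d0 ?D0 // ler_nat.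
have lnD0 : 0 <= ln (D%:R : R) by apply: ln_ge0; rewrite ler1n.
have half : (2 * n./2%:R : R) <= n%:R by rewrite -natrM ler_nat; lia.
have kR : (0 : R) <= k%:R by apply: ler0n.
have h1 : k%:R * (2 * n./2%:R) * ln (D%:R : R) <= k%:R * n%:R * ln D%:R.
  by rewrite ler_wpM2r // ler_wpM2l.
have h2 := ler_wpM2l kR (ln_factorial_half_ge R n n2).
lra.
Qed.

(** * Vanishing of the error terms *)

Lemma inv_ln_cvg0 (R : realType) : (ln (n%:R : R))^-1 @[n --> \oo] --> (0 : R).
Proof.
apply/gtr0_cvgV0.
  by near=> n; rewrite ln_gt0 // ltr1n; near: n; exact: nbhs_infty_gt.
apply/cvgryPge => A; near=> n.
rewrite -(expRK A) ler_ln ?posrE ?expR_gt0 //.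
  by near: n; exact: nbhs_infty_ger.
by rewrite ltr0n; near: n; exact: nbhs_infty_gt.
Unshelve. all: by end_near. Qed.

(** From d = n^e one gets ln d / ln n = e, so the quotient is eventually a / ln n + b e. *)
Lemma error_cvg0 (R : realType) (d : nat -> nat) (e : nat -> R) (a b : R) :
  e n @[n --> \oo] --> (0 : R) -> (\forall n \near \oo, (d n)%:R = n%:R `^ e n) ->
  (a + b * ln (d n)%:R) / ln n%:R @[n --> \oo] --> (0 : R).
Proof.
move=> e0 de.
apply: (@cvg_trans _ ((a * (ln (n%:R : R))^-1 + b * e n) @[n --> \oo])).
  apply: near_eq_cvg; near=> n.
  have lnn : (0 : R) < ln n%:R.
    by rewrite ln_gt0 // ltr1n; near: n; exact: nbhs_infty_gt.
  have -> : (d n)%:R = n%:R `^ e n :> R by near: n.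
  by rewrite ln_powR mulrDl; congr (_ + _); rewrite mulrA mulfK // gt_eqF.
have -> : (0 : R) = a * 0 + b * 0 by rewrite !mulr0 addr0.
apply: cvgD; first by apply: cvgMr; exact: inv_ln_cvg0.
by apply: cvgMr.
Unshelve. all: by end_near. Qed.

(** * From logarithms to the stated bounds *)

Lemma card_gt0_max_degree (U : sgraph) : (0 < max_degree U)%N -> (0 < #|U|)%N.
Proof.
rewrite !lt0n; apply: contra => /eqP /card0_eq U0.
by rewrite /max_degree big_pred0.
Qed.

Lemma le_expR_ln (R : realType) (N : nat) (x : R) :
  (0 < N)%N -> x <= ln N%:R -> expR x <= N%:R.
Proof. by move=> N0 xN; rewrite -[leRHS]lnK ?posrE ?ltr0n // ler_expR. Qed.

(** Since n^y = exp(y ln n), division by ln n moves a subtracted term x of the exponential bound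
    into the exponent of n. *)
Lemma powR_error (R : realType) (n : nat) (a x : R) : (2 <= n)%N ->
  n%:R `^ ((a - x / ln n%:R) * n%:R)
    = expR (n%:R * (a * ln n%:R - x)).
Proof.
move=> n2; have lnn : ln (n%:R : R) != 0 by rewrite gt_eqF // ln_gt0 // ltr1n.
rewrite /powR pnatr_eq0 gtn_eqF; last by lia.
by congr expR; field.
Qed.

Theorem theorem4p1 (R : realType) (Delta : nat) (hDelta : (1 <= Delta)%N) :
  (exists c : R, forall n d : nat, (2 <= n)%N -> (1 <= d)%N ->
     (forall U : sgraph, max_degree U = d -> induced_universal Delta n U ->
        expR (n%:R * ((Delta%:R / 2 - 1) * ln n%:R - c - ln (4 * d%:R)))
          <= #|U|%:R) /\
     (forall U' : sgraph, max_degree U' = d -> universal Delta n U' ->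
        expR (n%:R * ((Delta%:R / 2 - 1) * ln n%:R - c - ln (4 * d%:R)
                      - 2 * Delta%:R * ln (d%:R * expR 1 / Delta%:R)))
          <= #|U'|%:R)) /\
  (forall d : nat -> nat, (forall n, (2 <= n)%N -> (1 <= d n)%N) ->
     (exists2 e : nat -> R, e n @[n --> \oo] --> (0 : R) &
        \forall n \near \oo, (d n)%:R = n%:R `^ e n) ->
     (exists2 e : nat -> R, e n @[n --> \oo] --> (0 : R) &
        forall n : nat, (2 <= n)%N ->
        forall U : sgraph, max_degree U = d n -> induced_universal Delta n U ->
          n%:R `^ ((Delta%:R / 2 - 1 - e n) * n%:R) <= #|U|%:R) /\
     (exists2 e : nat -> R, e n @[n --> \oo] --> (0 : R) &
        forall n : nat, (2 <= n)%N ->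
        forall U' : sgraph, max_degree U' = d n -> universal Delta n U' ->
          n%:R `^ ((Delta%:R / 2 - 1 - e n) * n%:R) <= #|U'|%:R)).
Proof.
have DR : (0 : R) < Delta%:R by rewrite ltr0n.
have lnD0 : 0 <= ln (Delta%:R : R) by apply: ln_ge0; rewrite ler1n.
have ln40 : 0 <= ln (4 : R) by apply: ln_ge0; lra.
have ln4d d : (0 < d)%N -> ln (4 * d%:R) = ln 4 + ln d%:R :> R.
  by move=> d0; rewrite lnM ?posrE ?ltr0n.
have lnde d : (0 < d)%N ->
    ln (d%:R * expR 1 / Delta%:R) = ln d%:R + 1 - ln Delta%:R :> R.
  by move=> d0; rewrite ln_div ?posrE ?mulr_gt0 ?expR_gt0 ?ltr0n // lnM ?posrE
    ?expR_gt0 ?ltr0n // expRK.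
set bounds := (X in X /\ _); have part1 : bounds.
  (* With k = Delta - 2, the term 2 Delta absorbs the factorial loss 2k. The term 3 Delta ln Delta
     covers (k/2) ln Delta in the induced case; in the other case it offsets the 2 Delta ln Delta
     that - 2 Delta ln(de/Delta) gives back. *)
  exists (2 * Delta%:R + 3 * (Delta%:R * ln Delta%:R)) => n d n2 d1.
  have lnn0 : 0 <= ln (n%:R : R) by apply: ln_ge0; rewrite ler1n; lia.
  have lnd0 : 0 <= ln (d%:R : R) by apply: ln_ge0; rewrite ler1n.
  have nR : (0 : R) < n%:R by rewrite ltr0n; lia.
  have Dlnd : 0 <= Delta%:R * ln (d%:R : R) by rewrite mulr_ge0 // ltW.
  have DlnD : 0 <= Delta%:R * ln (Delta%:R : R) by rewrite mulr_ge0 // ltW.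
  have n0 : (0 < n)%N by lia.
  rewrite ln4d // lnde //.
  suff main (U : sgraph) : max_degree U = d ->
      (induced_universal Delta n U ->
        n%:R * ((Delta%:R / 2 - 1) * ln n%:R
          - (2 * Delta%:R + 3 * (Delta%:R * ln Delta%:R)) - (ln 4 + ln d%:R))
        <= ln (#|U|%:R : R)) /\
      (universal Delta n U ->
        n%:R * ((Delta%:R / 2 - 1) * ln n%:R
          - (2 * Delta%:R + 3 * (Delta%:R * ln Delta%:R)) - (ln 4 + ln d%:R)
          - 2 * Delta%:R * (ln d%:R + 1 - ln Delta%:R))
        <= ln (#|U|%:R : R)).
    split=> U degU univ; have [ind sub] := main U degU.
      by apply: le_expR_ln (ind univ); apply: card_gt0_max_degree; rewrite degU.
    by apply: le_expR_ln (sub univ); apply: card_gt0_max_degree; rewrite degU.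
  move=> degU; have U0 : (0 < #|U|)%N.
    by apply: card_gt0_max_degree; rewrite degU.
  have lnU0 : 0 <= ln (#|U|%:R : R) by apply: ln_ge0; rewrite ler1n.
  (* For [Delta = 1] both exponents are nonpositive, and [U] is nonempty. *)
  case: (Delta) hDelta DR lnD0 Dlnd DlnD => [//|[_ _ _ _ _|k _ DR lnD0 Dlnd DlnD]].
    split=> _; apply: le_trans lnU0; rewrite ln1 pmulr_rle0 //; lra.
  have kD : (k%:R : R) = k.+2%:R - 2 by rewrite -!natr1; lra.
  split=> univ.
    have := ln_card_ge R n k d k.+2 #|U| n2 d1 isT
      (induced_universal_count k n d U n0 d1 (eq_leq degU) univ).
    by apply: le_trans; rewrite ler_pM2l // kD; lra.
  (* Here [D = d], and 2 Delta ln d absorbs the cost (k/2) ln d. *)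
  have := ln_card_ge R n k d d #|U| n2 d1 d1
    (universal_count k n d U n0 d1 (eq_leq degU) univ).
  by apply: le_trans; rewrite ler_pM2l // kD; lra.
split=> // d d1 [e e0 de]; have [c hc] := part1; split.
  (* The error is c + ln(4d), the subtracted part of the exponent, divided by ln n. *)
  exists (fun n => (c + ln 4 + 1 * ln (d n)%:R) / ln n%:R).
    exact: error_cvg0 e0 de.
  move=> n n2 U degU univ; have [ind _] := hc n (d n) n2 (d1 n n2).
  apply: le_trans (ind U degU univ).
  rewrite powR_error // (ln4d _ (d1 n n2)) ler_expR le_eqVlt.
  by apply/orP; left; apply/eqP; ring.
(* [b] collects the subtracted terms free of [d]; ln d occurs once in ln(4d) and 2 Delta times in
   the last term. *)
pose b := c + ln 4 + 2 * Delta%:R * (1 - ln Delta%:R).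
exists (fun n => (b + (1 + 2 * Delta%:R) * ln (d n)%:R) / ln n%:R).
  exact: error_cvg0 e0 de.
move=> n n2 U degU univ; have [_ sub] := hc n (d n) n2 (d1 n n2).
apply: le_trans (sub U degU univ).
rewrite powR_error // (ln4d _ (d1 n n2)) (lnde _ (d1 n n2)) ler_expR le_eqVlt.
by apply/orP; left; apply/eqP; rewrite /b; ring.
Qed.
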